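(* There exists a merely finitely additive probability function $P$ on the Borel subsets of $\Omega=\{0,1\}^{\mathbb N}$ such that $P([\omega\upharpoonright n])>0$ for all $\omega\in\Omega$ and $n\in\mathbb N$, $P$ has the approximation property, and $P$ has the CHT property, but the posteriors of $P$ do not converge to the truth almost uniformly. Moreover, $P$ with all these properties can be chosen so that, in addition, its posteriors converge to the truth almost surely.
   Context: $\mathbb N=\{1,2,3,\dots\}$; $\Omega=\{0,1\}^{\mathbb N}$ carries the product topology ($\{0,1\}$ discrete), and $\mathcal B$ is its Borel $\sigma$-algebra. For $\omega\in\Omega$ and $n\in\mathbb N$, $[\omega\upharpoonright n]=\{\omega'\in\Omega:\omega'_i=\omega_i,\ 1\le i\le n\}$. Clopen means both open and closed. A probability function on $\mathcal B$ is a map $P:\mathcal B\to[0,1]$ with $P(\Omega)=1$ and $P(A\cup B)=P(A)+P(B)$ for disjoint $A,B\in\mathcal B$. It is merely finitely additive if it is not countably additive. If $P([\omega\upharpoonright n])>0$ for all $\omega,n$, the time-$n$ posterior of $A\in\mathcal B$ is $P_n(A)(\omega)=P(A\cap[\omega\upharpoonright n])/P([\omega\upharpoonright n])$. Approximation property: for every $A\in\mathcal B$ and $\varepsilon>0$ there is a clopen $C$ with $P(A\triangle C)<\varepsilon$. CHT property (countable additivity on conditional hitting times): for $A\in\mathcal B$, $\delta\in(0,1)$, let $C_n(A,\delta)=\{\omega:P_n(A)(\omega)>\delta\}$ and $D_n(A,\delta)=C_n(A,\delta)\setminus\bigcup_{j<n}C_j(A,\delta)$; the property is that $P\big(\bigcup_{n\ge1}D_n(A,\delta)\big)=\sum_{n\ge1}P(D_n(A,\delta))$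 for every $A\in\mathcal B$ and $\delta\in(0,1)$. The posteriors converge to the truth almost surely for $A$ if $P(\{\omega:P_n(A)(\omega)\to\mathbf 1_A(\omega)\})=1$. They converge to the truth almost uniformly for $A$ if for every $\varepsilon>0$ there is $E\in\mathcal B$ with $P(E)<\varepsilon$ such that for every $r>0$ there is $N\in\mathbb N$ with $|P_n(A)(\omega)-\mathbf 1_A(\omega)|<r$ for all $n\ge N$ and $\omega\notin E$. The posteriors converge to the truth almost surely (resp. almost uniformly), simpliciter, if they do so for every $A\in\mathcal B$. *)

(* Defs.v *)
From HB Require Import structures.
From mathcomp Require Import all_boot all_order all_algebra.
From mathcomp Require Import all_classical all_reals all_analysis.
Import Order.TTheory GRing.Theory Num.Theory.
Import numFieldNormedType.Exports.

Set Implicit Arguments.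
Unset Strict Implicit.
Unset Printing Implicit Defensive.

Local Open Scope classical_set_scope.
Local Open Scope ring_scope.

Notation Omega := cantor_space.

Definition borelOmega : measurableType (@open Omega).-sigma :=
  g_sigma_algebraType (@open Omega).

Definition borel (A : set Omega) : Prop := measurable (A : set borelOmega).

(* Coordinates of [Omega] are numbered from 0, so [w |` n] constrains the
   coordinates [0, ..., n - 1]. Times, on the other hand, start at 1: time 0
   (where the cylinder is the whole space) is excluded wherever it matters. *)
Definition cylinder (w : Omega) (n : nat) : set Omega :=
  [set w' | forall i, (i < n)%N -> w' i = w i].

Section Learning.
Context {R : realType}.
(* Only the values of [P] on Borel sets matter: every set to which [P] is
   applied below is Borel. *)
Variable P : set Omega -> R.

Definition probability_function : Prop :=
  [/\ forall A, borel A -> 0 <= P A <= 1,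
      P setT = 1 &
      additive2 (fun A : set borelOmega => (P A)%:E)].

Definition merely_finitely_additive : Prop :=
  probability_function /\
  ~ sigma_additive (fun A : set borelOmega => (P A)%:E).

Definition positive_on_cylinders : Prop :=
  forall (w : Omega) (n : nat), (1 <= n)%N -> 0 < P (cylinder w n).

Definition posterior (n : nat) (A : set Omega) (w : Omega) : R :=
  P (A `&` cylinder w n) / P (cylinder w n).

Definition approximation_property : Prop :=
  forall A (e : R), borel A -> 0 < e ->
    exists2 C : set Omega, clopen C & P (A `+` C) < e.

Definition exceed (A : set Omega) (delta : R) (n : nat) : set Omega :=
  [set w | posterior n A w > delta].

Definition hitting (A : set Omega) (delta : R) (n : nat) : set Omega :=
  exceed A delta n `\`
  \bigcup_(j in [set j | (1 <= j < n)%N]) exceed A delta j.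

Definition CHT_property : Prop :=
  forall A (delta : R), borel A -> 0 < delta < 1 ->
    \sum_(1 <= n < N) P (hitting A delta n) @[N --> \oo] -->
    P (\bigcup_(n in [set n | (1 <= n)%N]) hitting A delta n).

Definition converges_as_for (A : set Omega) : Prop :=
  P [set w | posterior n A w @[n --> \oo] --> (\1_A w : R)] = 1.

Definition converges_au_for (A : set Omega) : Prop :=
  forall e : R, 0 < e ->
    exists E : set Omega, [/\ borel E, P E < e &
      forall r : R, 0 < r ->
        exists2 N : nat, (1 <= N)%N &
          forall n, (N <= n)%N -> forall w, ~ E w ->
            `|posterior n A w - \1_A w| < r].

Definition converges_almost_surely : Prop :=
  forall A, borel A -> converges_as_for A.

Definition converges_almost_uniformly : Prop :=
  forall A, borel A -> converges_au_for A.

End Learning.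

(* Main.v *)
(* Let x_m = 0^m 1 0^oo, which tends to 0^oo. Inside the cylinder of 0^m 1 hang
   a dense countable set of "bush" atoms whose total mass is c_m times that of
   the atom x_m, where c_m = 1 / (column m + 1) and [column] takes every value
   infinitely often. P is the normalised sum of this atomic measure and of the
   0-1 charge u(A) = 1 iff {m | x_m in A} belongs to U, an ultrafilter refining
   a Fubini product of cofinite filters.
   - On clopen sets u is the point mass at 0^oo, so P is not countably additive;
     but clopen sets separate 0^oo and any finite set of atoms: approximation.
   - Every atom differs from 0^oo, so along it the posteriors eventually depend
     on the atomic measure only and converge; u lives on the x_m, hence almost
     sure convergence.
   - If x_m is not in A, the posterior of A at x_m equals the one at 0^oo up to
     time m and is at most c_m afterwards. As c_m tends to 0 along U, this gives
     the CHT property.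
   - If A is the set of all points other than the x_m, its posterior at x_m and
     time m + 1 is at least c_m / 4. A set of small probability misses U-many
     x_m, and c_m is constant on infinitely many of these: U is not a P-point.
     So the posteriors of A do not converge almost uniformly. *)
Require Import Defs.
From mathcomp Require Import all_boot all_order all_algebra.
From mathcomp Require Import all_classical all_reals all_analysis.
From mathcomp Require Import lra zify.
Import Order.TTheory GRing.Theory Num.Theory.
Import numFieldNormedType.Exports.

Set Implicit Arguments.
Unset Strict Implicit.
Unset Printing Implicit Defensive.

Local Open Scope classical_set_scope.
Local Open Scope ring_scope.

(** * Sets decided by finitely many coordinates *)

Section Prefixes.
Implicit Types (v w : Omega) (A C : set Omega) (n : nat).

Definition prefix_closed n C :=
  forall v w, cylinder v n w -> C v -> C w.

Lemma cylinder_refl w n : cylinder w n w.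
Proof. by []. Qed.

Lemma cylinder_eq v w n : cylinder v n w -> cylinder w n = cylinder v n.
Proof.
by move=> vw; apply/seteqP; split=> u uv i ni; rewrite uv ?vw.
Qed.

Lemma cylinder_le w m n : (m <= n)%N -> cylinder w n `<=` cylinder w m.
Proof. by move=> mn v vw i im; apply: vw; apply: leq_trans mn. Qed.

Lemma bigcap_cylinder w : \bigcap_n cylinder w n = [set w].
Proof.
apply/seteqP; split=> [v vw | _ -> //].
by apply/funext => i; apply: (vw i.+1).
Qed.

Lemma prefix_closed_cylinder w n : prefix_closed n (cylinder w n).
Proof. by move=> u v uv wu; rewrite -(cylinder_eq wu). Qed.

Lemma prefix_closedC n C : prefix_closed n C -> prefix_closed n (~` C).
Proof. by move=> pC v w vw nCv Cw; apply/nCv/(pC w) => // i /vw. Qed.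

Lemma prefix_closedD n C A :
  prefix_closed n C -> prefix_closed n A -> prefix_closed n (C `\` A).
Proof.
move=> pC pA v w vw [Cv nAv]; split; first exact: pC Cv.
exact: (prefix_closedC pA) nAv.
Qed.

Lemma prefix_closed_bigcup n (I : set nat) (F : nat -> set Omega) :
  (forall i, I i -> prefix_closed n (F i)) ->
  prefix_closed n (\bigcup_(i in I) F i).
Proof. by move=> pF v w vw [i Ii Fv]; exists i => //; apply: pF Fv. Qed.

Lemma prefix_closed_le m n C :
  (m <= n)%N -> prefix_closed m C -> prefix_closed n C.
Proof. by move=> mn pC v w vw; apply: pC; apply: cylinder_le vw. Qed.

Lemma open_cylinder w n : open (cylinder w n).
Proof.
have -> : cylinder w n =
    \bigcap_(i in `I_n) (proj i @^-1` [set w i] : set Omega).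
  by apply/seteqP; split.
rewrite bigcap_fset_set; last exact: finite_II.
elim/big_rec : _ => [|i A _ oA]; first exact: openT.
apply: openI => //; apply: open_comp; last exact: discrete_open.
by move=> u _; exact: (@proj_continuous nat (fun=> bool) i).
Qed.

Lemma clopen_prefix n C : prefix_closed n C -> clopen C.
Proof.
suff oC A : prefix_closed n A -> open A.
  move=> pC; split; first exact: oC.
  by rewrite -openC; apply/oC/prefix_closedC.
move=> pA; have -> : A = \bigcup_(w in A) cylinder w n.
  by apply/seteqP; split=> [w Aw|v [w Aw wv]]; [exists w | apply: pA Aw].
by apply: bigcup_open => w _; apply: open_cylinder.
Qed.

Lemma borel_prefix n C : prefix_closed n C -> borel C.
Proof. by move=> /clopen_prefix[oC _]; apply: sub_sigma_algebra. Qed.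

Lemma borel_cylinder w n : borel (cylinder w n).
Proof. by apply: (@borel_prefix n); apply: prefix_closed_cylinder. Qed.

Lemma borel_set1 w : borel [set w].
Proof.
by rewrite -bigcap_cylinder; apply: bigcapT_measurable => n;
  apply: borel_cylinder.
Qed.

(** Distinct points differ at some coordinate, and finitely many pairs share a bound. Repetitions in
    [a] are allowed. *)
Lemma separating_prefix N (a : nat -> Omega) :
  exists n, forall i j, (i < N)%N -> (j < N)%N ->
    cylinder (a i) n (a j) -> a i = a j.
Proof.
have sep (i j : 'I_N) : \forall n \near \oo,
    cylinder (a i) n (a j) -> a i = a j.
  have [-> | aij] := pselect (a i = a j); first exact: nearW.
  have [k aijk] : exists k, a i k <> a j k.
    by apply/existsNP => eqa; apply: aij; apply/funext.
  exists k.+1 => // n /= kn /(_ k kn) /esym //.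
have : \forall n \near \oo, forall i j : 'I_N,
    cylinder (a i) n (a j) -> a i = a j.
  by apply: filter_forall => i; apply: filter_forall => j; apply: sep.
move=> [n _ nP]; exists n => i j iN jN.
exact: (nP n (leqnn n) (Ordinal iN) (Ordinal jN)).
Qed.

End Prefixes.

(** * Columns of natural numbers and ultrafilters that are not P-points *)

Section ColumnFilter.

(** The 2-adic valuation of [m + 1]: column [i] consists of the numbers [2^i * q - 1] with [q]
    odd. *)
Definition column (m : nat) := logn 2 m.+1.

Lemma column_unbounded i b : exists2 m, (b <= m)%N & column m = i.
Proof.
have pos : (0 < 2 ^ i * (2 * b).+1)%N by rewrite muln_gt0 expn_gt0.
exists (2 ^ i * (2 * b).+1).-1.
  have : (0 < 2 ^ i)%N by rewrite expn_gt0.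
  by nia.
rewrite /column prednK// lognM ?expn_gt0// pfactorK//.
by rewrite logn_coprime ?addn0// prime_coprime// dvdn2 /= mul2n odd_double.
Qed.

(* The Fubini product of two copies of the cofinite filter; ultrafilters
   refining it are not P-points. *)
Definition column_filter : set_system nat :=
  [set S | exists a, forall i, (a <= i)%N ->
    exists b, forall m, (b <= m)%N -> column m = i -> S m].

Lemma column_filter_proper : ProperFilter column_filter.
Proof.
split.
  move=> [a /(_ a (leqnn a))[b bP]].
  by have [m bm ma] := column_unbounded a b; apply: (bP m).
split.
- by exists 0%N => i _; exists 0%N.
- move=> S T [a aS] [b bT]; exists (maxn a b) => i; rewrite geq_max => /andP[ai bi].
  have [c cS] := aS i ai; have [d dT] := bT i bi.
  exists (maxn c d) => m; rewrite geq_max => /andP[cm dm] mi.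
  by split; [apply: cS | apply: dT].
- move=> S T ST [a aS]; exists a => i /aS[b bS]; exists b => m bm mi.
  exact/ST/bS.
Qed.

Lemma column_filter_tail b : column_filter [set m | (b <= m)%N].
Proof. by exists 0%N => i _; exists b. Qed.

Lemma column_filter_columns a : column_filter [set m | (a <= column m)%N].
Proof. by exists a => i ai; exists 0%N => m _ /= ->. Qed.

Variable U : set_system nat.
Hypotheses (UU : UltraFilter U) (colU : column_filter `<=` U).

Lemma ultraC S : U (~` S) <-> ~ U S.
Proof.
have FU : ProperFilter U by exact: ultra_proper.
split=> [nUS US | nUS]; last by have [|] := in_ultra_setVsetC S UU.
apply: (@filter_not_empty _ U FU).
by rewrite -(setICr S); apply: filterI.
Qed.

(** Otherwise the complement of [S] would contain a tail of every column, hence lie in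
    [column_filter] and in [U]. This is how [U] fails to be a P-point. *)
Lemma ultra_unbounded_column S : U S ->
  exists i, forall b, exists m, [/\ (b <= m)%N, column m = i & S m].
Proof.
move=> US; apply: contrapT => nS; apply/ultraC : US.
apply/colU; exists 0%N => i _.
have /existsNP[b bS] :
    ~ forall b, exists m, [/\ (b <= m)%N, column m = i & S m].
  by move=> h; apply: nS; exists i.
by exists b => m bm mi Sm; apply: bS; exists m.
Qed.

End ColumnFilter.

(** * The atoms and their place in the binary tree *)

Section Atoms.

Definition origin : Omega := fun=> false.

Definition spike (m : nat) : Omega := fun i => i == m.

(* 0^m 1 (overwriting the first m + 1 entries of the k-th finite sequence), then
   the rest of that sequence, then 1^oo, so that a bush contains no spike. *)
Definition bush (m k : nat) : Omega := fun i =>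
  if (i <= m)%N then i == m else nth true (odflt [::] (unpickle k)) i.

Lemma cylinder_spike_origin m n : (n <= m)%N -> cylinder origin n (spike m).
Proof. by move=> nm i ni; rewrite /spike ltn_eqF// (leq_trans ni). Qed.

Lemma spike_neq_origin m : spike m <> origin.
Proof. by move=> /(congr1 (@^~ m)); rewrite /spike eqxx. Qed.

Lemma bush_neq_origin m k : bush m k <> origin.
Proof. by move=> /(congr1 (@^~ m)); rewrite /bush leqnn eqxx. Qed.

Lemma spike_inj : injective spike.
Proof. by move=> m n /(congr1 (@^~ m)); rewrite /spike eqxx => /esym/eqP. Qed.

Lemma bush_neq_spike m k n : bush m k <> spike n.
Proof.
move=> bs; pose s : seq bool := odflt [::] (unpickle k).
pose l := (maxn (size s) (maxn m n)).+1.
have := congr1 (@^~ l) bs; rewrite /bush /spike.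
have -> : (l <= m)%N = false by lia.
by rewrite nth_default -/s; lia.
Qed.

Lemma cylinder_bush m k : cylinder (spike m) m.+1 (bush m k).
Proof. by move=> i im; rewrite /bush /spike -ltnS im. Qed.

Lemma cylinder_spike_inj m n w :
  cylinder (spike m) m.+1 w -> cylinder (spike n) n.+1 w -> m = n.
Proof.
rewrite /spike => wm wn; case: (ltngtP m n) => // [mn|nm].
  have := wn m (leqW mn); rewrite wm// eqxx => /esym/eqP mn'; lia.
by have := wm n (leqW nm); rewrite wn// eqxx => /esym/eqP mn'; lia.
Qed.

(** Density of the bushes away from [origin]: [m] is the first coordinate where [w] is 1, and the
    overwritten sequence is the prefix of [w] of length [n]. *)
Lemma cylinder_has_bush (w : Omega) n : ~ cylinder w n origin ->
  exists m k, cylinder w n (bush m k).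
Proof.
move=> nw0.
have [i [ni wi]] : exists i, (i < n)%N /\ w i.
  apply: contrapT => h; apply: nw0 => i ni; apply/esym/negbTE/negP => wi.
  by apply: h; exists i.
case: (ex_minnP (ex_intro (fun i => w i) i wi)) => m wm mmin.
exists m, (pickle (mkseq w n)) => j jn; rewrite /bush pickleK/=.
case: (ltngtP j m) => [jm|jm|->]; last by rewrite wm.
- by apply/esym/negbTE/negP => /mmin; rewrite leqNgt jm.
- by rewrite nth_mkseq.
Qed.

End Atoms.

(** * The countably additive atomic measure *)

Section AtomicMeasure.
Context {R : realType}.
Implicit Types A B : set Omega.

(** Geometric weights of total 1, in the shape that [epsilon_trick0] sums. *)
Definition weight (k : nat) : R := 1 / (2 ^ k.+1)%:R.

(* The mass of the m-th bush relative to that of [spike m]. *)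
Definition spread (m : nat) : R := (column m).+1%:R^-1.

Lemma weight_gt0 k : 0 < weight k.
Proof. by rewrite /weight mul1r invr_gt0 ltr0n expn_gt0. Qed.

Lemma spread_gt0 m : 0 < spread m.
Proof. by rewrite /spread invr_gt0 ltr0n. Qed.

Lemma spread_le1 m : spread m <= 1.
Proof. by rewrite /spread invf_le1// ler1n. Qed.

Local Definition weight_nng k : {nonneg R} := NngNum (ltW (weight_gt0 k)).
Local Definition spread_nng m : {nonneg R} := NngNum (ltW (spread_gt0 m)).

Definition bush_measure m : {measure set borelOmega -> \bar R} :=
  mseries (fun k => mscale (weight_nng k) (\d_(bush m k : borelOmega))) 0.

Definition tree_measure : {measure set borelOmega -> \bar R} :=
  mseries (fun m => mscale (weight_nng m)
    (measure_add (\d_(spike m : borelOmega))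
                 (mscale (spread_nng m) (bush_measure m)))) 0.

Local Open Scope ereal_scope.

Lemma bush_measureE m A : bush_measure m A =
  \sum_(k <oo) (weight k)%:E * (\1_A (bush m k))%:E.
Proof. by []. Qed.

Lemma tree_measureE A : tree_measure A =
  \sum_(m <oo) (weight m)%:E *
    ((\1_A (spike m))%:E + (spread m)%:E * bush_measure m A).
Proof.
by apply: eq_eseriesr => m _; exact: (congr1 _ (measure_addE _ _ _)).
Qed.

Lemma weight_indic_ge0 k m A :
  0 <= (weight k)%:E * (\1_A (bush m k) : R)%:E.
Proof. by apply: mule_ge0; rewrite lee_fin // ltW// weight_gt0. Qed.

Lemma bush_measure_le1 m A : bush_measure m A <= 1.
Proof.
rewrite bush_measureE; apply: le_trans (epsilon_trick0 xpredT ler01).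
apply: lee_nneseries => [k _ _|k _]; first exact: weight_indic_ge0.
by rewrite -EFinM lee_fin ler_piMr// ?ltW ?weight_gt0// indicE; case: (_ \in _).
Qed.

Lemma tree_term_ge0 m A : 0 <= (weight m)%:E *
    ((\1_A (spike m))%:E + (spread m)%:E * bush_measure m A).
Proof.
apply: mule_ge0; first by rewrite lee_fin ltW// weight_gt0.
apply: adde_ge0; first by rewrite lee_fin.
by apply: mule_ge0 => //; rewrite lee_fin ltW// spread_gt0.
Qed.

Lemma term_le_nneseries (f : (\bar R)^nat) k :
  (forall i, 0 <= f i) -> f k <= \sum_(i <oo) f i.
Proof.
move=> f0; rewrite (@nneseriesD1 _ _ k)// leeDl//.
by apply: nneseries_ge0 => i _ _.
Qed.

Lemma tree_measure_term m A : (weight m)%:E *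
    ((\1_A (spike m))%:E + (spread m)%:E * bush_measure m A) <= tree_measure A.
Proof.
rewrite tree_measureE.
exact: (@term_le_nneseries (fun m => _) m (fun i => tree_term_ge0 i A)).
Qed.

Lemma tree_term_le m A : (weight m)%:E *
    ((\1_A (spike m))%:E + (spread m)%:E * bush_measure m A) <=
  (weight m * (\1_A (spike m) + spread m))%:E.
Proof.
rewrite [leRHS]EFinM EFinD lee_pmul2l// ?lte_fin ?weight_gt0// leeD2l//.
rewrite -[leRHS]mule1 lee_pmul2l ?lte_fin ?spread_gt0//.
exact: bush_measure_le1.
Qed.

Lemma tree_measure_le2 A : tree_measure A <= 2%:E.
Proof.
rewrite tree_measureE; apply: le_trans (epsilon_trick0 xpredT (ler0n R 2)).
apply: lee_nneseries => [m _ _|m _]; first exact: tree_term_ge0.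
apply: le_trans (tree_term_le m A) _; rewrite lee_fin /weight.
rewrite mulrAC ler_pM2r ?invr_gt0 ?ltr0n ?expn_gt0// mul1r.
rewrite (_ : 2%R = 1 + 1)%R// lerD ?spread_le1//.
Qed.

Lemma tree_measure_fin A : tree_measure A \is a fin_num.
Proof.
by rewrite ge0_fin_numE// (le_lt_trans (tree_measure_le2 A))// ltry.
Qed.

Local Close Scope ereal_scope.

Definition tree A : R := fine (tree_measure A).

Lemma EFin_tree A : (tree A)%:E = tree_measure A.
Proof. by rewrite fineK// tree_measure_fin. Qed.

Lemma tree_ge0 A : 0 <= tree A.
Proof. by rewrite -lee_fin EFin_tree. Qed.

Lemma tree_spike A m : A (spike m) -> weight m <= tree A.
Proof.
move=> Am; rewrite -lee_fin EFin_tree.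
apply: le_trans (tree_measure_term m A).
rewrite -[leLHS]mule1 lee_pmul2l ?lte_fin ?weight_gt0//.
rewrite indicE mem_set// leeDl//.
by apply: mule_ge0 => //; rewrite lee_fin ltW// spread_gt0.
Qed.

Lemma tree_bush A m k : A (bush m k) ->
  weight m * (spread m * weight k) <= tree A.
Proof.
move=> Am; rewrite -lee_fin EFin_tree.
apply: le_trans (tree_measure_term m A).
rewrite [leLHS]EFinM lee_pmul2l ?lte_fin ?weight_gt0//.
apply: (@le_trans _ _ ((spread m)%:E * bush_measure m A)%E); last first.
  by rewrite leeDr// lee_fin indicE.
rewrite [leLHS]EFinM lee_pmul2l ?lte_fin ?spread_gt0//.
apply: le_trans (term_le_nneseries k (fun i => weight_indic_ge0 i m A)).
by rewrite indicE mem_set// mule1.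
Qed.

Lemma bush_measure_eq0 m A :
  (forall k, ~ A (bush m k)) -> bush_measure m A = 0%E.
Proof.
move=> nA; rewrite bush_measureE eseries0// => k _ _.
by rewrite indicE memNset// mule0.
Qed.

(** Cylinders of different prefixes [0^m 1] are disjoint, so only the [m]-th term of the series
    survives, and a bush has mass at most 1. *)
Lemma tree_cylinder_le A m : A `<=` cylinder (spike m) m.+1 ->
  tree A <= weight m * (\1_A (spike m) + spread m).
Proof.
move=> Am; rewrite -lee_fin EFin_tree; apply: le_trans (tree_term_le m A).
rewrite tree_measureE (@nneseriesD1 _ _ m)//; last by move=> k _; exact: tree_term_ge0.
rewrite eseries0 ?adde0// => k _ /= km.
have nA w : cylinder (spike k) k.+1 w -> ~ A w.
  by move=> wk /Am /(cylinder_spike_inj wk) => /eqP; rewrite (negbTE km).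
rewrite indicE memNset; last exact/nA/cylinder_refl.
by rewrite bush_measure_eq0 ?mule0 ?adde0 ?mule0// => j; apply/nA/cylinder_bush.
Qed.

Lemma tree_null A : (forall m, ~ A (spike m)) -> (forall m k, ~ A (bush m k)) ->
  tree A = 0.
Proof.
move=> nAs nAb; apply: EFin_inj; rewrite EFin_tree tree_measureE.
rewrite eseries0// => m _ _.
by rewrite indicE memNset// bush_measure_eq0 ?mule0 ?adde0 ?mule0.
Qed.

(** The measure sees only its atoms. Stated for arbitrary sets, so as to cover the set where the
    posteriors converge. *)
Lemma tree_eq A B : (forall m, A (spike m) <-> B (spike m)) ->
  (forall m k, A (bush m k) <-> B (bush m k)) -> tree A = tree B.
Proof.
have indicP (w : Omega) : (A w <-> B w) -> (\1_A w : R) = \1_B w.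
  by move=> AB; rewrite !indicE; congr ((_ : bool)%:R); apply/idP/idP;
    rewrite !inE => /AB.
move=> ABs ABb; congr fine; rewrite !tree_measureE.
apply: eq_eseriesr => m _; rewrite (indicP _ (ABs m)) !bush_measureE.
by congr (_ * (_ + _ * _))%E; apply: eq_eseriesr => k _; rewrite indicP.
Qed.

Lemma tree_le A B : borel A -> borel B -> A `<=` B -> tree A <= tree B.
Proof. by move=> mA mB AB; rewrite -lee_fin !EFin_tree le_measure ?inE. Qed.

Lemma treeU A B : borel A -> borel B -> A `&` B = set0 ->
  tree (A `|` B) = tree A + tree B.
Proof.
move=> mA mB AB; apply: EFin_inj; rewrite EFinD !EFin_tree.
by rewrite measureU.
Qed.

Lemma cvg_tree_bigcup (F : nat -> set Omega) :
  (forall n, borel (F n)) -> trivIset setT F ->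
  (fun n => \sum_(0 <= i < n) tree (F i)) @ \oo --> tree (\bigcup_n F n).
Proof.
move=> mF tF.
have -> : (fun n => \sum_(0 <= i < n) tree (F i)) =
    fine \o (fun n => \sum_(0 <= i < n) tree_measure (F i))%E.
  apply/funext => n /=; apply: EFin_inj; rewrite -sumEFin fineK.
    by apply: eq_bigr => i _; rewrite EFin_tree.
  by apply/sum_fin_numP => i _ _; apply: tree_measure_fin.
apply: fine_cvg; rewrite EFin_tree.
apply: (@measure_semi_sigma_additive _ borelOmega _ tree_measure F) => //.
exact: bigcupT_measurable.
Qed.

Lemma cvg_tree_bigcap (F : nat -> set Omega) :
  (forall n, borel (F n)) -> nonincreasing_seq F ->
  tree (F n) @[n --> \oo] --> tree (\bigcap_n F n).
Proof.
move=> mF niF; apply: (@fine_cvg _ _ _ _ (tree_measure \o F)); rewrite EFin_tree.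
apply: nonincreasing_cvg_mu => //.
- by rewrite -EFin_tree ltry.
- exact: bigcapT_measurable.
Qed.

End AtomicMeasure.

(** * The 0-1 charge, its sum with the atomic measure, and posteriors *)

Section Learner.
Context {R : realType} (U : set_system nat).
Hypotheses (UU : UltraFilter U) (colU : column_filter `<=` U).
Implicit Types (A B C : set Omega).

Local Instance properU : ProperFilter U := @ultra_proper _ _ UU.

(** The charge u: the [U]-limit of the point masses at [spike m]. *)
Definition limit A : R := \1_U (spike @^-1` A).

Definition mass A : R := limit A + tree A.

Definition learner A : R := mass A / mass setT.

Lemma limit1 A : U (spike @^-1` A) -> limit A = 1.
Proof. by move=> UA; rewrite /limit indicE mem_set. Qed.

Lemma limit0 A : ~ U (spike @^-1` A) -> limit A = 0.
Proof. by move=> UA; rewrite /limit indicE memNset. Qed.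

Lemma limit_ge0 A : 0 <= limit A.
Proof. by rewrite /limit indicE. Qed.

Lemma limit_le A B : A `<=` B -> limit A <= limit B.
Proof.
move=> AB; have [UA | /limit0->] := pselect (U (spike @^-1` A)).
  by rewrite !limit1//; apply: filterS UA => m; apply: AB.
exact: limit_ge0.
Qed.

Lemma limitU A B : A `&` B = set0 -> limit (A `|` B) = limit A + limit B.
Proof.
move=> AB0.
have [UA | nUA] := pselect (U (spike @^-1` A)).
  rewrite (limit1 UA) limit1; last by apply: filterS UA => m; left.
  rewrite limit0 ?addr0// => UB; apply: (@filter_not_empty _ U _).
  have := filterI UA UB; rewrite -preimage_setI AB0 preimage_set0; exact.
rewrite (limit0 nUA) add0r.
have [UB | nUB] := pselect (U (spike @^-1` B)).
  by rewrite !limit1//; apply: filterS UB => m; right.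
rewrite !limit0// => UAB.
move/(ultraC UU) : nUA => UA; apply: nUB.
by apply: filterS (filterI UAB UA) => m [[Am /(_ Am)|//]].
Qed.

(** [U] contains every tail, and [spike m] shares its first [n] coordinates with [origin] once
    [n <= m]. So on sets decided by finitely many coordinates the charge is the point mass at
    [origin]. *)
Lemma limit_prefix n C : prefix_closed n C -> limit C = \1_C origin.
Proof.
have in1 D : prefix_closed n D -> D origin -> U (spike @^-1` D).
  move=> pD D0; apply: filterS (colU (column_filter_tail n)) => m /= nm.
  exact/(pD _ _ _ D0)/cylinder_spike_origin.
move=> pC; have [C0 | nC0] := pselect (C origin).
  by rewrite limit1 ?indicE ?mem_set//; apply: in1.
rewrite limit0 ?indicE ?memNset//; apply/(ultraC UU).
exact: (in1 _ (prefix_closedC pC)).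
Qed.

Lemma limit_cylinder_eq0 w n A : ~ cylinder w n origin ->
  A `<=` cylinder w n -> limit A = 0.
Proof.
move=> nw0 /limit_le; rewrite (limit_prefix (@prefix_closed_cylinder w n)).
by rewrite indicE memNset// => A0; apply/eqP; rewrite eq_le A0 limit_ge0.
Qed.

Lemma spike_cylinder_origin m n : (m < n)%N -> ~ cylinder (spike m) n origin.
Proof. by move=> mn /(_ m mn); rewrite /spike eqxx. Qed.

Lemma limitT : limit setT = 1.
Proof. by apply: limit1; exact: filterT. Qed.

Lemma mass_ge0 A : 0 <= mass A.
Proof. by rewrite addr_ge0// ?limit_ge0// tree_ge0. Qed.

Lemma mass_le A B : borel A -> borel B -> A `<=` B -> mass A <= mass B.
Proof. by move=> mA mB AB; rewrite lerD// ?limit_le// tree_le. Qed.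

Lemma massU A B : borel A -> borel B -> A `&` B = set0 ->
  mass (A `|` B) = mass A + mass B.
Proof. by move=> mA mB AB; rewrite /mass limitU// treeU// addrACA. Qed.

Lemma massT_gt0 : 0 < mass setT.
Proof. by rewrite /mass limitT ltr_pwDl// tree_ge0. Qed.

(** [limit] charges the cylinders around [origin]; any other cylinder contains a bush atom. *)
Lemma mass_cylinder_gt0 w n : 0 < mass (cylinder w n).
Proof.
have [w0 | nw0] := pselect (cylinder w n origin).
  rewrite /mass (limit_prefix (@prefix_closed_cylinder w n)) indicE mem_set//.
  by rewrite ltr_pwDl// tree_ge0.
have [m [k wmk]] := cylinder_has_bush nw0.
rewrite /mass ltr_wpDl ?limit_ge0//; apply: lt_le_trans (tree_bush wmk).
by rewrite !mulr_gt0// ?weight_gt0// spread_gt0.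
Qed.

Lemma borelI A B : borel A -> borel B -> borel (A `&` B).
Proof. exact: measurableI. Qed.

Lemma borelT : borel setT.
Proof. exact: measurableT. Qed.

Lemma posteriorE n A w :
  posterior learner n A w = mass (A `&` cylinder w n) / mass (cylinder w n).
Proof.
have := mass_cylinder_gt0 w n; have := massT_gt0.
rewrite /posterior /learner => /lt0r_neq0 T0 /lt0r_neq0 C0.
by rewrite invf_div mulrA divfK.
Qed.

Lemma cylinder_posterior n A v w : cylinder v n w ->
  posterior learner n A w = posterior learner n A v.
Proof. by move=> vw; rewrite !posteriorE (cylinder_eq vw). Qed.

Lemma learner_probability_function : probability_function learner.
Proof.
split=> [A mA | | A B mA mB AB].
- rewrite divr_ge0 ?mass_ge0//= ler_pdivrMr ?massT_gt0// mul1r.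
  exact: (mass_le mA borelT).
- by rewrite /learner divff// gt_eqF// massT_gt0.
- by rewrite -EFinD /learner massU// mulrDl.
Qed.

Lemma learner_positive : positive_on_cylinders learner.
Proof. by move=> w n _; rewrite divr_gt0// ?massT_gt0// mass_cylinder_gt0. Qed.

(** * Failure of countable additivity *)

Lemma borel_spikes : borel (range spike).
Proof.
have -> : range spike = \bigcup_m [set spike m].
  by apply/seteqP; split=> w [m _]; [move=> <-; exists m|move=> ->; exists m].
by apply: bigcupT_measurable => m; apply: borel_set1.
Qed.

(** Each single spike has charge 0 but their union has charge 1, while [tree] is countably additive:
    the series falls short by [1 / mass setT]. *)
Lemma learner_not_sigma_additive :
  ~ sigma_additive (fun A : set borelOmega => (learner A)%:E).
Proof.
pose F m : set Omega := [set spike m].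
have mF m : borel (F m) by exact: borel_set1.
have tF : trivIset setT F.
  apply/trivIsetP => i j _ _ ij; apply/seteqP.
  by split=> // w [-> /spike_inj/eqP];
    rewrite (negbTE ij).
move=> /(_ F mF tF) cvgF.
have lF0 i : limit (F i) = 0.
  apply: (@limit_cylinder_eq0 (spike i) i.+1); first exact: spike_cylinder_origin.
  by move=> _ ->.
have cvgt : (fun n => \sum_(0 <= i < n) (learner (F i))%:E)%E @ \oo -->
    (tree (\bigcup_n F n) / mass setT)%:E.
  have -> : (fun n => \sum_(0 <= i < n) (learner (F i))%:E)%E =
      EFin \o (fun n => (\sum_(0 <= i < n) tree (F i)) / mass setT).
    apply/funext => n /=; rewrite sumEFin mulr_suml; congr EFin.
    by apply: eq_bigr => i _; rewrite /learner /mass lF0 add0r.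
  apply: cvg_EFin; first exact: nearW.
  by apply: cvgMr_tmp; apply: cvg_tree_bigcup.
have : learner (\bigcup_n F n) = tree (\bigcup_n F n) / mass setT.
  by apply: EFin_inj; exact: (cvg_unique _ cvgF cvgt).
have Z0 : (mass setT)^-1 != 0 by rewrite invr_neq0// gt_eqF// massT_gt0.
rewrite /learner => /(mulIf Z0); rewrite /mass limit1; first lra.
by apply: filterS (@filterT _ U _) => m _; exists m.
Qed.

(** * Countable additivity on hitting times *)

(** On these sets [limit] inherits countable additivity from the point mass at [origin]. This can
    fail only if the union misses [origin] but still has charge 1, which the last hypothesis
    excludes. *)
Lemma learner_cvg_bigcup (F : nat -> set Omega) :
  (forall n, exists k, prefix_closed k (F n)) -> trivIset setT F ->
  (~ (\bigcup_n F n) origin -> limit (\bigcup_n F n) = 0) ->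
  (fun n => \sum_(0 <= i < n) learner (F i)) @ \oo --> learner (\bigcup_n F n).
Proof.
move=> pF tF lF.
have mF n : borel (F n) by have [k /borel_prefix] := pF n.
have -> : (fun n => \sum_(0 <= i < n) learner (F i)) = (fun n =>
    (\sum_(0 <= i < n) limit (F i) + \sum_(0 <= i < n) tree (F i)) / mass setT).
  by apply/funext => n; rewrite -big_split/= mulr_suml.
apply: cvgMr_tmp; apply: cvgD; last exact: cvg_tree_bigcup.
have limE A : ((exists k, prefix_closed k A) \/ limit A = \1_A origin) ->
    limit A = fine (\d_(origin : borelOmega) A).
  by move=> [[k /limit_prefix ->]|->].
rewrite limE; last first.
  right; have [[n _ Fn0] | nF0] := pselect ((\bigcup_n F n) origin).
    (* Some [F n] contains [origin] and has charge 1, which forces charge 1 for the union. *)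
    rewrite [RHS]indicE mem_set; last by exists n.
    have [k /limit_prefix Fn] := pF n; apply/eqP; rewrite eq_le.
    rewrite -{1}limitT limit_le//=; apply: le_trans (limit_le (@bigcup_sup _ _ n setT F I)).
    by rewrite Fn indicE mem_set.
  by rewrite lF// indicE memNset.
have -> : (fun n => \sum_(0 <= i < n) limit (F i)) =
    fine \o (fun n => \sum_(0 <= i < n) \d_(origin : borelOmega) (F i))%E.
  apply/funext => n /=; rewrite sumEFin /=; apply: eq_bigr => i _.
  by rewrite limE//; left.
apply: fine_cvg; rewrite fineK//.
apply: (@measure_semi_sigma_additive _ borelOmega R (\d_(origin : borelOmega)) F) => //.
exact: bigcupT_measurable.
Qed.

Lemma prefix_closed_exceed A delta n :
  prefix_closed n (exceed learner A delta n).
Proof. by move=> v w vw; rewrite /exceed/= (cylinder_posterior _ vw). Qed.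

Lemma prefix_closed_hitting A delta n :
  prefix_closed n (hitting learner A delta n).
Proof.
apply: prefix_closedD; first exact: prefix_closed_exceed.
apply: prefix_closed_bigcup => j /andP[_ jn].
exact/(prefix_closed_le (ltnW jn))/prefix_closed_exceed.
Qed.

Lemma cvg_tree_cylinder A w : borel A ->
  tree (A `&` cylinder w n) @[n --> \oo] --> (tree (A `&` [set w]) : R).
Proof.
move=> mA; have -> : A `&` [set w] = \bigcap_n (A `&` cylinder w n).
  by rewrite -bigcap_cylinder; apply/seteqP; split=> [v [Av wv] n _|v Avw];
    split=> //; [apply: wv|case: (Avw 0%N I)|move=> n _; case: (Avw n I)].
apply: cvg_tree_bigcap => [n | m n mn].
  by apply: borelI => //; apply: borel_cylinder.
by rewrite subsetEset; apply: setIS; apply: cylinder_le.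
Qed.

(** If [U] contained this index set, [A] would have mass at least 1 in every cylinder around
    [origin]. The mass of these cylinders tends to 1 since [origin] is no atom, so the posteriors
    would come arbitrarily close to 1. *)
Lemma posterior_origin A delta : borel A -> delta < 1 ->
  (forall n, (1 <= n)%N -> posterior learner n A origin <= delta) ->
  ~ U (spike @^-1` A).
Proof.
move=> mA d1 pd UA.
have cvgT : delta * (1 + tree (cylinder origin n)) @[n --> \oo] -->
    delta * (1 + 0 : R).
  apply: cvgMl_tmp; apply: cvgD; first exact: cvg_cst.
  rewrite -[X in _ --> X](@tree_null R [set origin]).
  - have := @cvg_tree_cylinder setT origin borelT; rewrite setTI.
    by under eq_fun do rewrite setTI.
  - exact: spike_neq_origin.
  - exact: bush_neq_origin.
suff : 1 <= delta * (1 + 0) by rewrite addr0 mulr1 leNgt d1.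
apply: (cvgr_to_ge cvgT); exists 1%N => // n /= n1.
have := pd n n1; rewrite posteriorE ler_pdivrMr ?mass_cylinder_gt0//.
rewrite /mass (limit_prefix (@prefix_closed_cylinder origin n)).
rewrite indicE mem_set//=; apply: le_trans.
rewrite limit1 ?lerDl ?tree_ge0//; rewrite preimage_setI.
apply: filterI UA _; apply: filterS (colU (column_filter_tail n)) => m /= nm.
exact: cylinder_spike_origin.
Qed.

(** Up to time [m] the two cylinders coincide. Later the charge vanishes, [A] retains at most the
    bush, of mass at most [weight m * spread m], and the cylinder has at least the mass [weight m]
    of its spike. *)
Lemma posterior_spike n m A delta : ~ A (spike m) -> spread m <= delta ->
  posterior learner n A origin <= delta ->
  posterior learner n A (spike m) <= delta.
Proof.
move=> nAm md; have [nm | mn] := leqP n m.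
  by rewrite (cylinder_posterior A (cylinder_spike_origin nm)).
move=> _; apply: le_trans md; rewrite posteriorE ler_pdivrMr ?mass_cylinder_gt0//.
have sub : A `&` cylinder (spike m) n `<=` cylinder (spike m) m.+1.
  by apply: subset_trans (@subIsetr _ _ _) _; apply: cylinder_le.
rewrite /mass (limit_cylinder_eq0 (spike_cylinder_origin (leqnn _)) sub).
rewrite add0r; apply: le_trans (tree_cylinder_le sub) _.
rewrite indicE memNset ?add0r; last by case.
rewrite mulrC ler_pM2l ?spread_gt0// ler_wpDl ?limit_ge0//.
exact/tree_spike/cylinder_refl.
Qed.

Lemma tree0 : tree set0 = 0 :> R.
Proof. by rewrite tree_null => [|m []|m k []]. Qed.

Lemma mass0 : mass set0 = 0.
Proof. by rewrite /mass tree0 addr0 limit0//; apply: filter_not_empty. Qed.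

Lemma learner_CHT : CHT_property learner.
Proof.
move=> A delta mA /andP[d0 d1].
pose D n := hitting learner A delta n.
(* Times start at 1: the empty set is put at time 0, so that union and series run over all of
   [nat]. *)
pose F n := if n is n'.+1 then D n'.+1 else set0.
have -> : \bigcup_(n in [set n | (1 <= n)%N]) D n = \bigcup_n F n.
  apply/seteqP; split=> w [[|n] // n1 Dw]; first by exists n.+1.
  by exists n.+1.
have -> : (fun N => \sum_(1 <= n < N) learner (D n)) =
    (fun N => \sum_(0 <= n < N) learner (F n)).
  apply/funext => -[|N]; first by rewrite !big_geq.
  rewrite [RHS]big_ltn// [learner (F 0%N)](_ : _ = 0) ?add0r.
    by apply: eq_big_nat => -[].
  by rewrite /learner mass0 mul0r.
apply: learner_cvg_bigcup.
- case=> [|n]; first by exists 0%N.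
  by exists n.+1; apply: prefix_closed_hitting.
- have Fdisj i j w : (i < j)%N -> F i w -> F j w -> False.
    case: i j => [|i] [|j]//= ij [Ei _] [_ nEj]; apply: nEj.
    by exists i.+1.
  apply/trivIsetP => i j _ _; rewrite neq_ltn => /orP[ij|ji];
    apply/seteqP; split=> // w [Fi Fj].
    exact: Fdisj ij Fi Fj.
  exact: Fdisj ji Fj Fi.
move=> nF0.
(* Strong induction on time: a first exceedance would put [w] in a hitting set. *)
have nexc w : ~ (\bigcup_n F n) w ->
    forall n, (1 <= n)%N -> posterior learner n A w <= delta.
  move=> nFw n; elim/ltn_ind: n => -[//|n] IH _.
  rewrite leNgt; apply/negP => En; apply: nFw; exists n.+1 => //.
  split=> // -[j /andP[j1 jn] Ej].
  by have := IH j jn j1; rewrite leNgt Ej.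
have nUA := posterior_origin mA d1 (nexc _ nF0).
apply: limit0; apply/(ultraC UU).
(* As a function of the column, [spread] is the harmonic sequence, so it is at most [delta] on all
   columns from some [a] on; [U] contains their union. *)
have [a ad] : exists a, forall m, (a <= column m)%N -> spread m <= delta.
  have [a _ aP] := cvgr_le _ (@cvg_harmonic R) _ d0.
  by exists a => m /aP.
have Ucol := colU (column_filter_columns a).
have /(ultraC UU) UnA := nUA.
(* Spikes outside [A] in these columns are in no hitting set, and [U] contains the set of their
   indices. *)
apply: filterS (filterI Ucol UnA) => m /= [am nAm] [[|n] _ //= [En _]].
have := posterior_spike nAm (ad m am) (nexc _ nF0 n.+1 isT).
by rewrite leNgt => /negP; apply.
Qed.

(** * Failure of almost uniform convergence *)

Lemma learner_not_au : ~ converges_almost_uniformly learner.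
Proof.
pose A : set Omega := ~` range spike.
have mA : borel A by apply: measurableC; exact: borel_spikes.
have Z0 := massT_gt0.
(* A set of probability below [1 / mass setT] has mass below 1, hence charge 0. *)
move=> /(_ A mA (mass setT)^-1); rewrite invr_gt0 => /(_ Z0) [E [mE PE unif]].
have nUE : ~ U (spike @^-1` E).
  move=> UE; move: PE; rewrite /learner -[ltRHS]mul1r ltr_pM2r ?invr_gt0//.
  by rewrite /mass limit1// ltNge lerDl tree_ge0.
have /(ultraC UU) /(ultra_unbounded_column UU colU)[i iP] := nUE.
(* In the 4, one factor 2 comes from the cylinder mass, at most [2 * weight m], the other from
   [weight 0 = 1/2] for the first bush atom. Staying in column [i] makes the bound independent of
   [m]. *)
have r0 : 0 < (i.+1%:R : R)^-1 / 4 by rewrite divr_gt0// invr_gt0 ltr0n.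
have [N N1 NP] := unif _ r0.
have [m [Nm mi nEm]] := iP N.
(* Time [m + 1] is the first at which the prefix of [spike m] excludes [origin], so only the atomic
   measure counts. *)
have := NP m.+1 (leqW Nm) (spike m) nEm.
apply/negP; rewrite -leNgt -mi -/(spread m).
rewrite indicE memNset; last by apply; exists m.
rewrite subr0; apply: le_trans (ler_norm _).
rewrite posteriorE ler_pdivlMr ?mass_cylinder_gt0//.
have cylsub : cylinder (spike m) m.+1 `<=` cylinder (spike m) m.+1 by [].
have lim0 : limit (cylinder (spike m) m.+1) = 0.
  exact: (limit_cylinder_eq0 (spike_cylinder_origin (leqnn _)) cylsub).
have Ab : (A `&` cylinder (spike m) m.+1) (bush m 0).
  split; last exact: cylinder_bush.
  by move=> [n _ /esym/bush_neq_spike].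
apply: (@le_trans _ _ (weight m * (spread m * weight 0))); last first.
  by apply: le_trans (tree_bush Ab) _; rewrite lerDr limit_ge0.
rewrite /mass lim0 add0r.
apply: (@le_trans _ _ (spread m / 4 * (weight m * 2))).
  rewrite ler_pM2l ?divr_gt0 ?spread_gt0//; apply: le_trans (tree_cylinder_le cylsub) _.
  rewrite ler_pM2l ?weight_gt0// indicE mem_set; last exact: cylinder_refl.
  by have := @spread_le1 R m; rewrite /=; lra.
by rewrite {3}/weight expn1; lra.
Qed.

(** * Almost sure convergence *)

(** Cylinders around [w] eventually exclude [origin], so the posteriors become ratios of [tree]
    masses. Both terms converge by continuity from above, the denominator to the positive mass of
    [w]. *)
Lemma cvg_posterior_atom A w :
  borel A -> w <> origin -> 0 < (tree [set w] : R) ->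
  posterior learner n A w @[n --> \oo] --> (\1_A w : R).
Proof.
move=> mA w0 tw.
have cvgm B : borel B ->
    mass (B `&` cylinder w n) @[n --> \oo] --> tree (B `&` [set w]).
  move=> mB; apply: (cvg_trans _ (@cvg_tree_cylinder B w mB)).
  apply: near_eq_cvg.
  have [k wk] : exists k, w k.
    apply: contrapT => h; apply: w0; apply/funext => k.
    by apply/negbTE/negP => wk; apply: h; exists k.
  exists k.+1 => // n /= kn.
  rewrite /mass (@limit_cylinder_eq0 w n) ?add0r//.
  by move=> /(_ k kn); rewrite wk.
(* [setT] is intersected in the denominator so that [cvgm] covers both terms. *)
under eq_fun do rewrite posteriorE -[X in _ / mass X]setTI.
have -> : (\1_A w : R) = tree (A `&` [set w]) / tree (setT `&` [set w]).
  rewrite setTI indicE; have [Aw | nAw] := pselect (A w).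
    rewrite mem_set// (_ : A `&` _ = [set w]) ?divff ?gt_eqF//.
    by apply/seteqP; split=> [v []|v ->].
  have -> : A `&` [set w] = set0.
    by apply/seteqP; split=> // v [Av vw]; apply: nAw; rewrite -vw.
  by rewrite memNset// tree0 mul0r.
apply: cvgM; first exact: cvgm.
by apply: cvgV; [rewrite setTI gt_eqF|apply: cvgm; exact: borelT].
Qed.

Lemma learner_as : converges_almost_surely learner.
Proof.
move=> A mA; rewrite /converges_as_for.
set S := [set w | _].
have Ss m : S (spike m).
  apply: cvg_posterior_atom => //; first exact: spike_neq_origin.
  by apply: lt_le_trans (weight_gt0 m) _; apply: tree_spike.
have Sb m k : S (bush m k).
  apply: cvg_posterior_atom => //; first exact: bush_neq_origin.
  apply: lt_le_trans (tree_bush (erefl : [set bush m k] (bush m k))).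
  by rewrite !mulr_gt0 ?weight_gt0 ?spread_gt0.
rewrite /learner [mass S]/mass (tree_eq (B := setT))// limit1; last first.
  by apply: filterS (@filterT _ U _) => m _; apply: Ss.
have -> : 1 + tree setT = mass setT by rewrite /mass limitT.
by rewrite divff// gt_eqF// massT_gt0.
Qed.

(** * Approximation by clopen sets *)

(** One sequence through all spikes and bushes. Codes that decode to nothing give [spike 0], so
    every value is an atom. *)
Definition atom (k : nat) : Omega :=
  match unpickle k : option (nat + nat * nat) with
  | Some (inr (m, j)) => bush m j
  | Some (inl m) => spike m
  | None => spike 0
  end.

Lemma atom_neq_origin k : atom k <> origin.
Proof.
rewrite /atom; case: unpickle => [[m|[m j]]|]; by
  [apply: spike_neq_origin | apply: bush_neq_origin].
Qed.

(** The sets decrease to one without atoms. *)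
Lemma cvg_tree_atoms :
  tree (~` \bigcup_(k in `I_n) [set atom k]) @[n --> \oo] --> (0 : R).
Proof.
rewrite -[X in _ --> X](@tree_null R
  (\bigcap_n ~` \bigcup_(k in `I_n) [set atom k])).
- apply: cvg_tree_bigcap => [n|m n mn].
    apply: measurableC; apply: bigcup_measurable => k _; exact: borel_set1.
  rewrite subsetEset; apply: subsetC => w [k km ->]; exists k => //=.
  exact: leq_trans mn.
- move=> m /(_ (pickle (inl m : nat + nat * nat)).+1 I); apply.
  by exists (pickle (inl m : nat + nat * nat)) => //=; rewrite /atom pickleK.
- move=> m j /(_ (pickle (inr (m, j) : nat + nat * nat)).+1 I); apply.
  by exists (pickle (inr (m, j) : nat + nat * nat)) => //=; rewrite /atom pickleK.
Qed.

(** Finitely many atoms carry all but little of [tree]. [C] agrees with [A] on these atoms and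
    contains [origin] exactly when [A] has charge 1; the symmetric difference then has charge 0 and
    misses those atoms. *)
Lemma learner_approximation : approximation_property learner.
Proof.
move=> A e mA e0.
have Z0 := massT_gt0.
have eZ : 0 < e * mass setT by rewrite mulr_gt0.
have [N _ /(_ N (leqnn N)) /= tN] := cvgr_lt _ cvg_tree_atoms _ eZ.
(* [origin] gets index 0, ahead of the atoms; there membership in [A] is replaced by the charge of
   [A]. *)
pose a k := if k is k'.+1 then atom k' else origin.
pose inA k := if k is k'.+1 then A (atom k') else U (spike @^-1` A).
have [n sep] := separating_prefix N.+1 a.
pose C := \bigcup_(k in [set k | (k < N.+1)%N /\ inA k]) cylinder (a k) n.
have pC : prefix_closed n C.
  by apply: prefix_closed_bigcup => k _; apply: prefix_closed_cylinder.
have Ca k : (k < N.+1)%N -> C (a k) <-> inA k.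
  move=> kN; split=> [[j [jN inAj] /(sep _ _ jN kN)]|inAk]; last by exists k.
  (* [inA] is defined on indices: equal points need equal answers, and [origin] is no atom. *)
  case: j k {jN kN} inAj => [|j] [|k]//= inAj.
  - by move=> /esym/atom_neq_origin.
  - by move=> /atom_neq_origin.
  - by move=> <-.
exists C; first exact: clopen_prefix pC.
have mC : borel C := borel_prefix pC.
(* The charge of [C] is read off at [origin], where [C] was made to match the charge of [A]. *)
have CU : U (spike @^-1` C) <-> U (spike @^-1` A).
  have := limit_prefix pC; rewrite -[U (_ A)]/(inA 0) -(Ca 0%N)//= indicE.
  have [C0|nC0] := pselect (C origin).
    by rewrite mem_set// => lC; split=> // _; apply: contrapT => /limit0 /eqP;
      rewrite lC oner_eq0.
  by rewrite memNset// => lC; split=> // /limit1 /eqP; rewrite lC eq_sym oner_eq0.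
rewrite /learner ltr_pdivrMr// /mass limit0 ?add0r; last first.
  move=> UAC; have [UA|nUA] := pselect (U (spike @^-1` A)).
    apply: (@filter_not_empty _ U _); have /CU UC := UA.
    by apply: filterS (filterI UAC (filterI UA UC)) => m /= [] [[]|[]] + + [].
  apply: (@filter_not_empty _ U _).
  have /(ultraC UU) UnA := nUA.
  have /(ultraC UU) UnC : ~ U (spike @^-1` C) by rewrite CU.
  by apply: filterS (filterI UAC (filterI UnA UnC)) => m /= [] [[]|[]] + + [].
apply: le_lt_trans tN; apply: tree_le.
- by apply: measurableU; apply: measurableD.
- by apply: measurableC; apply: bigcup_measurable => k _; exact: borel_set1.
move=> w ACw [k /= kN wk]; move: ACw; rewrite wk => -[[Aw nCw]|[Cw nAw]].
  by apply: nCw; apply/(Ca k.+1).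
by apply: nAw; apply/(Ca k.+1 _).1.
Qed.

End Learner.

Theorem theorem6p9 (R : realType) :
  (exists P : set Omega -> R,
    [/\ merely_finitely_additive P,
        positive_on_cylinders P,
        approximation_property P,
        CHT_property P &
        ~ converges_almost_uniformly P]) /\
  (exists P : set Omega -> R,
    [/\ merely_finitely_additive P,
        positive_on_cylinders P,
        approximation_property P,
        CHT_property P &
        ~ converges_almost_uniformly P] /\
    converges_almost_surely P).
Proof.
have [U [UU colU]] := ultraFilterLemma column_filter_proper.
have props : [/\ merely_finitely_additive (@learner R U),
    positive_on_cylinders (@learner R U), approximation_property (@learner R U),
    CHT_property (@learner R U) & ~ converges_almost_uniformly (@learner R U)].
  split.
  - split; first exact: learner_probability_function.
    exact: learner_not_sigma_additive.
  - exact: learner_positive.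
  - exact: learner_approximation.
  - exact: learner_CHT.
  - exact: learner_not_au.
split; first by exists (@learner R U).
by exists (@learner R U); split=> //; apply: learner_as.
Qed.
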